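(* Let $L = U+E_8(-1)$ with the $\mathbb{Z}$-basis $g_1,\dots,g_{10}$ and let $D=\{\sum_{i=1}^{10}\alpha_i g_i \mid \alpha_i\in\mathbb{R}_{\ge 0}\}$ be the fundamental domain described in the context. The primitive non-isotropic vectors of $L$ of norm at most $30$ lying in $D$ are exactly the following, listed by norm: \begin{itemize} \item norm $2$: $g_2$; \item norm $4$: $g_1+g_2$, $g_3$; \item norm $6$: $2g_1+g_2$, $g_4$; \item norm $8$: $3g_1+g_2$, $g_1+g_3$; \item norm $10$: $4g_1+g_2$, $g_1+g_4$, $g_5$; \item norm $12$: $5g_1+g_2$, $g_1+2g_2$, $2g_1+g_3$, $g_6$; \item norm $14$: $6g_1+g_2$, $2g_1+g_4$, $g_2+g_3$; \item norm $16$: $7g_1+g_2$, $3g_1+g_3$, $g_2+g_4$, $g_1+g_5$; \item norm $18$: $8g_1+g_2$, $3g_1+g_4$, $g_7$, $g_1+g_6$; \item norm $20$: $9g_1+g_2$, $3g_1+2g_2$, $4g_1+g_3$, $g_1+g_2+g_3$, $g_8$; \item norm $22$: $10g_1+g_2$, $4g_1+g_4$, $2g_1+g_5$, $g_1+g_2+g_4$, $g_3+g_4$; \item norm $24$: $11g_1+g_2$, $g_1+3g_2$, $5g_1+g_3$, $g_1+2g_3$, $2g_1+g_6$, $g_2+g_5$; \item norm $26$: $12g_1+g_2$, $5g_1+g_4$, $2g_1+g_2+g_3$, $g_1+g_7$, $g_2+g_6$; \item norm $28$: $13g_1+g_2$, $5g_1+2g_2$, $6g_1+g_3$, $2g_2+g_3$,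 $3g_1+g_5$, $g_3+g_5$, $2g_1+g_2+g_4$, $g_1+g_8$; \item norm $30$: $14g_1+g_2$, $2g_1+3g_2$, $6g_1+g_4$, $2g_2+g_4$, $3g_1+g_6$, $g_9$, $g_1+g_3+g_4$. \end{itemize}
   Context: $U$ is the hyperbolic plane and $E_8(-1)$ the negative definite $E_8$-lattice; $L=U+E_8(-1)$ is the even unimodular lattice of signature $(1,9)$. The norm of $v\in L$ is $v^2=v\cdot v$; $v$ is isotropic if $v^2=0$. A fundamental domain $D$ of the Weyl group of $L$ (the group generated by the reflections in vectors $r\in L$ with $r^2=-2$) is bounded by $10$ facets, orthogonal to simple roots whose Coxeter–Dynkin diagram is that of $E_{10}$. It is a simplicial cone whose extreme rays have generators $g_1,\dots,g_{10}$ forming a $\mathbb{Z}$-basis of $L$, with Gram matrix $(g_i\cdot g_j)_{1\le i,j\le 10}$ equal to $$W=\left(\begin{array}{cccccccccc} 0 & 1 & 2 & 2 & 3 & 3 & 4 & 4 & 5 & 6\\ 1 & 2 & 4 & 4 & 6 & 6 & 8 & 8 & 10 & 12\\ 2 & 4 & 4 & 6 & 7 & 8 & 9 & 10 & 12 & 14\\ 2 & 4 & 6 & 6 & 9 & 9 & 12 & 12 & 15 & 18\\ 3 & 6 & 7 & 9 & 10 & 12 & 14 & 15 & 18 & 21\\ 3 & 6 & 8 & 9 & 12 & 12 & 16 & 16 & 20 & 24\\ 4 & 8 & 9 & 12 & 14 & 16 & 18 & 20 & 24 & 28\\ 4 & 8 & 10 & 12 & 15 & 16 & 20 & 20 & 25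 & 30\\ 5 & 10 & 12 & 15 & 18 & 20 & 24 & 25 & 30 & 36\\ 6 & 12 & 14 & 18 & 21 & 24 & 28 & 30 & 36 & 42 \end{array}\right).$$ Hence $D=\{\sum_{i=1}^{10}\alpha_i g_i\mid\alpha_i\in\mathbb{R}_{\ge0}\}$. A vector of $L$ is primitive if it is not an integer multiple $mw$ of some $w\in L$ with $m\geq 2$. *)

(* Defs.v *)
From HB Require Import structures.
From mathcomp Require Import all_boot all_order all_algebra.
From mathcomp Require Import reals.

Set Implicit Arguments.
Unset Strict Implicit.
Unset Printing Implicit Defensive.

Import Order.TTheory GRing.Theory Num.Theory.

Local Open Scope ring_scope.

Definition mx_of_rows (m n : nat) (s : seq (seq int)) : 'M[int]_(m, n) :=
  \matrix_(i < m, j < n) nth 0 (nth [::] s i) j.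

Definition gramU : 'M[int]_2 := mx_of_rows 2 2
  [:: [:: 0; 1];
      [:: 1; 0] ].

(* Cartan matrix of E8, Bourbaki numbering of the nodes. *)
Definition gramE8 : 'M[int]_8 := mx_of_rows 8 8
  [:: [::  2;  0; -1;  0;  0;  0;  0;  0];
      [::  0;  2;  0; -1;  0;  0;  0;  0];
      [:: -1;  0;  2; -1;  0;  0;  0;  0];
      [::  0; -1; -1;  2; -1;  0;  0;  0];
      [::  0;  0;  0; -1;  2; -1;  0;  0];
      [::  0;  0;  0;  0; -1;  2; -1;  0];
      [::  0;  0;  0;  0;  0; -1;  2; -1];
      [::  0;  0;  0;  0;  0;  0; -1;  2] ].

(* The underlying group of the lattice U + E_8(-1); its form is [dot] below. *)
Notation L := 'rV[int]_(2 + 8).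

Definition gramL : 'M[int]_(2 + 8) := block_mx gramU 0 0 (- gramE8).

Definition dot (v w : L) : int := (v *m gramL *m w^T) 0 0.

Definition sqnorm (v : L) : int := dot v v.

Definition isotropic (v : L) : Prop := sqnorm v = 0.

Definition primitive (v : L) : Prop :=
  ~ exists (m : int) (w : L), 2 <= m /\ v = m *: w.

Definition Zbasis (g : 'I_10 -> L) : Prop :=
  forall v : L, exists! c : 'rV[int]_10, v = \sum_(i < 10) c 0 i *: g i.

Definition W : 'M[int]_10 := mx_of_rows 10 10
  [:: [:: 0;  1;  2;  2;  3;  3;  4;  4;  5;  6];
      [:: 1;  2;  4;  4;  6;  6;  8;  8; 10; 12];
      [:: 2;  4;  4;  6;  7;  8;  9; 10; 12; 14];
      [:: 2;  4;  6;  6;  9;  9; 12; 12; 15; 18];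
      [:: 3;  6;  7;  9; 10; 12; 14; 15; 18; 21];
      [:: 3;  6;  8;  9; 12; 12; 16; 16; 20; 24];
      [:: 4;  8;  9; 12; 14; 16; 18; 20; 24; 28];
      [:: 4;  8; 10; 12; 15; 16; 20; 20; 25; 30];
      [:: 5; 10; 12; 15; 18; 20; 24; 25; 30; 36];
      [:: 6; 12; 14; 18; 21; 24; 28; 30; 36; 42] ].

(* The inverse of W, i.e. the Gram matrix of the dual basis, is that of the
   simple roots of E_10 (norms -2, adjacent nodes having product 1).  Any two
   bases with Gram matrix W are exchanged by an isometry of L, so each of them
   generates the extreme rays of a fundamental domain of the Weyl group. *)
Definition E10_weights (g : 'I_10 -> L) : Prop :=
  Zbasis g /\ forall i j : 'I_10, dot (g i) (g j) = W i j.

Definition realify (R : realType) (v : L) : 'rV[R]_(2 + 8) :=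
  map_mx (fun z : int => z%:~R) v.

Definition D (R : realType) (g : 'I_10 -> L) (x : 'rV[R]_(2 + 8)) : Prop :=
  exists a : 'I_10 -> R,
    (forall i, 0 <= a i) /\ x = \sum_(i < 10) a i *: realify R (g i).

Definition vectors_by_norm (g : 'I_10 -> L) : seq (int * seq L) :=
  let g1 := g (inord 0) in let g2 := g (inord 1) in
  let g3 := g (inord 2) in let g4 := g (inord 3) in
  let g5 := g (inord 4) in let g6 := g (inord 5) in
  let g7 := g (inord 6) in let g8 := g (inord 7) in
  let g9 := g (inord 8) in
  [:: (2, [:: g2]);
      (4, [:: g1 + g2; g3]);
      (6, [:: g1 *+ 2 + g2; g4]);
      (8, [:: g1 *+ 3 + g2; g1 + g3]);
      (10, [:: g1 *+ 4 + g2; g1 + g4; g5]);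
      (12, [:: g1 *+ 5 + g2; g1 + g2 *+ 2; g1 *+ 2 + g3; g6]);
      (14, [:: g1 *+ 6 + g2; g1 *+ 2 + g4; g2 + g3]);
      (16, [:: g1 *+ 7 + g2; g1 *+ 3 + g3; g2 + g4; g1 + g5]);
      (18, [:: g1 *+ 8 + g2; g1 *+ 3 + g4; g7; g1 + g6]);
      (20, [:: g1 *+ 9 + g2; g1 *+ 3 + g2 *+ 2; g1 *+ 4 + g3; g1 + g2 + g3;
               g8]);
      (22, [:: g1 *+ 10 + g2; g1 *+ 4 + g4; g1 *+ 2 + g5; g1 + g2 + g4;
               g3 + g4]);
      (24, [:: g1 *+ 11 + g2; g1 + g2 *+ 3; g1 *+ 5 + g3; g1 + g3 *+ 2;
               g1 *+ 2 + g6; g2 + g5]);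
      (26, [:: g1 *+ 12 + g2; g1 *+ 5 + g4; g1 *+ 2 + g2 + g3; g1 + g7;
               g2 + g6]);
      (28, [:: g1 *+ 13 + g2; g1 *+ 5 + g2 *+ 2; g1 *+ 6 + g3; g2 *+ 2 + g3;
               g1 *+ 3 + g5; g3 + g5; g1 *+ 2 + g2 + g4; g1 + g8]);
      (30, [:: g1 *+ 14 + g2; g1 *+ 2 + g2 *+ 3; g1 *+ 6 + g4; g2 *+ 2 + g4;
               g1 *+ 3 + g6; g9; g1 + g3 + g4])].

(* Main.v *)
Require Import Defs.
From mathcomp Require Import all_boot all_order all_algebra.
From mathcomp Require Import reals.

(** In the coordinates of the basis the Gram matrix has nonnegative entries, and
    its only zero is the norm of the first vector. Hence on the cone [D], where
    all coordinates are nonnegative, the norm is monotone in each coordinate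
    ([leq_norm]), and it bounds every coordinate of a non-isotropic vector
    ([coord_leq_norm]). The non-isotropic lattice vectors of [D] of norm at most
    30 therefore form a finite set, which is enumerated coordinate by
    coordinate, discarding every partial vector whose norm already exceeds 30
    ([mem_short_tails]).

    The conditions on [v] are read off its coordinates: membership in [D] means
    that the integral coordinates are nonnegative ([D_comb]), and primitivity
    that their gcd is 1 ([primitive_comb]). An evaluation then compares the
    enumerated vectors of gcd 1 with the list of the theorem
    ([short_table_complete], [short_table_sound]). *)

Import GRing.Theory Num.Theory.

Local Open Scope ring_scope.

(** * Coordinates with respect to the basis *)

Definition basis_mx (g : 'I_10 -> L) : 'M[int]_(10, 2 + 8) := \matrix_i g i.

(** Vectors of [D] have nonnegative coordinates; these are kept as sequences of
    naturals so that the final enumeration can be evaluated. Missing entries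
    count as zero. *)
Definition comb (g : 'I_10 -> L) (s : seq nat) : L :=
  \sum_(i < 10) g i *+ nth 0%N s i.

Definition coord (s : seq nat) : 'rV[int]_10 := \row_i (nth 0%N s i)%:Z.

Lemma mul_basis_mx g (c : 'rV[int]_10) :
  c *m basis_mx g = \sum_(i < 10) c 0 i *: g i.
Proof. by rewrite mulmx_sum_row; apply: eq_bigr => i _; rewrite rowK. Qed.

Lemma comb_coord g s : comb g s = coord s *m basis_mx g.
Proof.
rewrite mul_basis_mx; apply: eq_bigr => i _.
by rewrite mxE -natz scaler_nat.
Qed.

(** Writing the standard basis vectors in terms of [g] produces the inverse of
    [basis_mx g] over the integers. *)
Lemma Zbasis_inverse g : Zbasis g ->
  exists B : 'M[int]_(2 + 8, 10),
    B *m basis_mx g = 1%:M /\ basis_mx g *m B = 1%:M.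
Proof.
move=> gP.
have [c cP] : exists c : 'I_(2 + 8) -> 'rV[int]_10,
    forall i, delta_mx 0 i = c i *m basis_mx g.
  apply: (@fin_all_exists _ _ (fun i (d : 'rV_10) => _ = d *m _)) => i.
  by have [d [dP _]] := gP (delta_mx 0 i); exists d; rewrite mul_basis_mx.
have BG : (\matrix_i c i) *m basis_mx g = 1%:M.
  by apply/row_matrixP => i; rewrite row_mul rowK -cP row1.
by exists (\matrix_i c i); split; last exact: (@mulmx1C _ 10).
Qed.

(** An integral basis stays linearly independent over the reals, since it has
    an integral inverse; so the real coordinates defining [D] are the integral
    ones. *)
Lemma D_comb (R : realType) g (v : L) : Zbasis g ->
  D g (realify R v) <-> exists2 s, size s = 10 & v = comb g s.
Proof.
move=> gP; split.
  have [B [BG GB]] := Zbasis_inverse _ gP.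
  case=> a [a_ge0 vE]; set c := v *m B.
  have vc : v = c *m basis_mx g by rewrite -mulmxA BG mulmx1.
  pose f : {rmorphism int -> R} := intmul 1.
  have ca i : (c 0 i)%:~R = a i :> R.
    have -> : (c 0 i)%:~R = (map_mx f v *m map_mx f B) 0 i.
      by rewrite -map_mxM [RHS]mxE.
    have -> : map_mx f v = (\row_j a j) *m map_mx f (basis_mx g).
      rewrite mulmx_sum_row [LHS]vE; apply: eq_bigr => j _.
      by rewrite mxE -map_row rowK.
    by rewrite -mulmxA -map_mxM GB map_mx1 mulmx1 mxE.
  exists [seq absz (c 0 i) | i <- enum 'I_10].
    by rewrite size_map size_enum_ord.
  rewrite comb_coord vc; congr (_ *m _); apply/rowP => i; rewrite [RHS]mxE.
  rewrite (nth_map i) ?size_enum_ord // nth_ord_enum gez0_abs //.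
  by rewrite -(ler0z R) ca.
case=> s _ ->; exists (fun i => (nth 0%N s i)%:R); split=> [i|].
  exact: ler0n.
rewrite /realify raddf_sum; apply: eq_bigr => i _.
by rewrite raddfMn /= scaler_nat.
Qed.

Lemma dvdn_foldr_gcdn (d : nat) s :
  (d %| foldr gcdn 0%N s)%N = all (dvdn d) s.
Proof. by elim: s => [|x s IHs] /=; rewrite ?dvdn0 // dvdn_gcd IHs. Qed.

(** Since [g] is an integral basis, an integer divides a vector exactly when it
    divides all its coordinates. *)
Lemma primitive_comb g s : Zbasis g -> (size s <= 10)%N ->
  primitive (comb g s) <-> foldr gcdn 0%N s = 1%N.
Proof.
move=> gP s10; have [B [BG GB]] := Zbasis_inverse _ gP; split.
  move=> prim; set k := foldr gcdn 0%N s; apply/eqP/contraT => k_neq1.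
  (* The zero vector, where the gcd is zero, is divisible by 2. *)
  have [d d_gt1 dk] : exists2 d, (1 < d)%N & (d %| k)%N.
    case: k k_neq1 => [|[|k]] // _; first by exists 2%N.
    by exists k.+2.
  case: prim; exists d%:Z, (comb g [seq (x %/ d)%N | x <- s]).
  split; first by rewrite lez_nat.
  rewrite !comb_coord scalemxAl; congr (_ *m _); apply/rowP => i.
  rewrite !mxE -PoszM; congr Posz.
  have [le_s|lt_s] := leqP (size s) i.
    by rewrite !nth_default ?size_map ?muln0.
  rewrite (nth_map 0%N) // mulnC divnK //.
  by move: dk; rewrite dvdn_foldr_gcdn => /all_nthP; apply.
move=> gcd1 [m [w [m_ge2 vE]]].
have cE : coord s = m *: (w *m B).
  by rewrite scalemxAl -vE comb_coord -mulmxA GB mulmx1.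
have : (`|m| %| foldr gcdn 0 s)%N.
  rewrite dvdn_foldr_gcdn; apply/(all_nthP 0%N) => i lt_i.
  have /rowP/(_ (Ordinal (leq_trans lt_i s10))) := cE.
  rewrite !mxE /= => /(congr1 absz) /=; rewrite abszM => ->.
  exact: dvdn_mulr.
by rewrite gcd1 dvdn1; case: m m_ge2 {vE cE} => // -[|[|]].
Qed.

(** * The norm in coordinates *)

(** The entries of [W] once more: matrices are locked, which would block the
    evaluations below. *)
Definition weight_rows : seq (seq nat) :=
  [:: [:: 0;  1;  2;  2;  3;  3;  4;  4;  5;  6];
      [:: 1;  2;  4;  4;  6;  6;  8;  8; 10; 12];
      [:: 2;  4;  4;  6;  7;  8;  9; 10; 12; 14];
      [:: 2;  4;  6;  6;  9;  9; 12; 12; 15; 18];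
      [:: 3;  6;  7;  9; 10; 12; 14; 15; 18; 21];
      [:: 3;  6;  8;  9; 12; 12; 16; 16; 20; 24];
      [:: 4;  8;  9; 12; 14; 16; 18; 20; 24; 28];
      [:: 4;  8; 10; 12; 15; 16; 20; 20; 25; 30];
      [:: 5; 10; 12; 15; 18; 20; 24; 25; 30; 36];
      [:: 6; 12; 14; 18; 21; 24; 28; 30; 36; 42] ].

Definition weight (i j : nat) : nat := nth 0%N (nth [::] weight_rows i) j.

(** The product with the [i]-th basis vector. *)
Definition pairing (s : seq nat) (i : nat) : nat :=
  sumn [seq weight i j * nth 0 s j | j <- iota 0 10]%N.

Definition norm (s : seq nat) : nat :=
  sumn [seq nth 0 s i * pairing s i | i <- iota 0 10]%N.

Lemma W_weight i j : W i j = (weight i j)%:Z.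
Proof.
rewrite mxE; case: i => i; case: j => j /=.
by do 10?[case: j => [|j]] => // _; do 10?[case: i => [|i]].
Qed.

Lemma pairingE s i : pairing s i = (\sum_(j < 10) weight i j * nth 0 s j)%N.
Proof.
by rewrite /pairing sumnE big_map -[iota 0 10]/(index_iota 0 10) big_mkord.
Qed.

Lemma normE s : norm s = (\sum_(i < 10) nth 0 s i * pairing s i)%N.
Proof.
by rewrite /norm sumnE big_map -[iota 0 10]/(index_iota 0 10) big_mkord.
Qed.

Lemma sqnorm_comb g s : E10_weights g -> sqnorm (comb g s) = (norm s)%:Z.
Proof.
case=> _ gram.
have Posz_sum (F : 'I_10 -> nat) : (\sum_i F i)%N%:Z = \sum_i (F i)%:Z.
  exact: (big_morph Posz PoszD).
have GW : basis_mx g *m gramL *m (basis_mx g)^T = W.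
  apply/matrixP => i j; rewrite -gram /dot !mxE; apply: eq_bigr => k _.
  rewrite !mxE; congr (_ * _); apply: eq_bigr => l _.
  by rewrite !mxE.
rewrite /sqnorm /dot comb_coord trmx_mul !mulmxA.
rewrite -[_ *m _ *m gramL *m _]mulmxA -[_ *m _ *m (_ *m _)]mulmxA.
rewrite (mulmxA _ gramL) GW -mulmxA mxE normE Posz_sum.
apply: eq_bigr => i _.
rewrite PoszM [coord s 0 i]mxE pairingE Posz_sum mxE; congr (_ * _).
by apply: eq_bigr => j _; rewrite W_weight !mxE.
Qed.

Lemma leq_norm s t : (forall i, nth 0 s i <= nth 0 t i)%N ->
  (norm s <= norm t)%N.
Proof.
move=> st; rewrite !normE; apply: leq_sum => i _; apply: leq_mul => //.
by rewrite !pairingE; apply: leq_sum => j _; rewrite leq_mul.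
Qed.

(** The only zero of the Gram matrix is the norm of the first basis vector, so
    a vector of nonzero norm has another nonzero coordinate, pairs positively
    with every basis vector, and each coordinate contributes at least its own
    value to the norm. *)
Lemma coord_leq_norm s i : (i < 10)%N -> (0 < norm s)%N ->
  (nth 0 s i <= norm s)%N.
Proof.
have weight_gt0 j k : (j < 10)%N -> (0 < k < 10)%N -> (0 < weight j k)%N.
  have W0 : all (fun j => all (fun k => 0 < weight j k)%N (iota 1 9))
    (iota 0 10) by [].
  by move=> j10 k10; apply: (allP (allP W0 j _)); rewrite mem_iota.
move=> i10 norm_gt0.
have [j j0 sj] : exists2 j : 'I_10, (0 < j)%N & (0 < nth 0 s j)%N.
  apply/exists_inP; apply: contraTT norm_gt0 => /exists_inPn s0.
  rewrite -eqn0Ngt normE big1 // => k _.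
  have [k0|k_gt0] := posnP k; last first.
    by have := s0 k k_gt0; rewrite -eqn0Ngt => /eqP ->.
  rewrite pairingE big1 ?muln0 // => l _.
  have [l0|l_gt0] := posnP l; first by rewrite k0 l0.
  by have := s0 l l_gt0; rewrite -eqn0Ngt => /eqP ->; rewrite muln0.
have pair_gt0 : (0 < pairing s i)%N.
  rewrite pairingE (bigD1 j) //= addn_gt0 muln_gt0 sj weight_gt0 //.
  by rewrite j0 ltn_ord.
rewrite normE (bigD1 (Ordinal i10)) //=.
by rewrite (leq_trans _ (leq_addr _ _)) // leq_pmulr.
Qed.

(** * Enumeration of the short vectors *)

Definition extensions (tails : seq (seq nat)) : seq (seq nat) :=
  [seq x :: s | s <- tails, x <- iota 0 31].

(** Collects the possible last [m] coordinates of a non-isotropic vector of norm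
    at most 30. By monotonicity of the norm, zeroing the first coordinates of
    such a vector leaves its norm at most 30, so longer tails only extend tails
    already found; and a new coordinate is at most 30 by [coord_leq_norm]. *)
Fixpoint short_tails (m : nat) : seq (seq nat) :=
  if m is m'.+1 then
    [seq s <- extensions (short_tails m')
     | norm (nseq (10 - m) 0 ++ s) <= 30]%N
  else [:: [::]].

Lemma mem_short_tails s : size s = 10 -> (0 < norm s <= 30)%N ->
  s \in short_tails 10.
Proof.
move=> s10 /andP[norm_gt0 norm_le].
suff H m : (m <= 10)%N -> drop (10 - m) s \in short_tails m.
  by have := H 10 (leqnn _); rewrite subnn drop0.
elim: m => [|m IHm] m10; first by rewrite subn0 drop_oversize ?s10.
rewrite [short_tails _]/= mem_filter.
have lt10 : (10 - m.+1 < 10)%N by rewrite ltn_subrL.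
apply/andP; split.
  apply: leq_trans norm_le; apply: leq_norm => i.
  rewrite nth_cat size_nseq nth_nseq; case: ltnP => [//|le_i].
  by rewrite nth_drop subnKC.
rewrite (drop_nth 0%N) ?s10 // -subSn // subSS.
apply/allpairsP; exists (drop (10 - m) s, nth 0%N s (10 - m.+1)).
split=> //; first exact: IHm (ltnW m10).
by rewrite mem_iota ltnS (leq_trans (coord_leq_norm _ _ lt10 norm_gt0)).
Qed.

(** The coordinates of the listed vectors, without trailing zeros. *)
Definition short_table : seq (nat * seq (seq nat)) :=
  [:: (2, [:: [:: 0; 1]]);
      (4, [:: [:: 1; 1]; [:: 0; 0; 1]]);
      (6, [:: [:: 2; 1]; [:: 0; 0; 0; 1]]);
      (8, [:: [:: 3; 1]; [:: 1; 0; 1]]);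
      (10, [:: [:: 4; 1]; [:: 1; 0; 0; 1]; [:: 0; 0; 0; 0; 1]]);
      (12, [:: [:: 5; 1]; [:: 1; 2]; [:: 2; 0; 1]; [:: 0; 0; 0; 0; 0; 1]]);
      (14, [:: [:: 6; 1]; [:: 2; 0; 0; 1]; [:: 0; 1; 1]]);
      (16, [:: [:: 7; 1]; [:: 3; 0; 1]; [:: 0; 1; 0; 1]; [:: 1; 0; 0; 0; 1]]);
      (18, [:: [:: 8; 1]; [:: 3; 0; 0; 1]; [:: 0; 0; 0; 0; 0; 0; 1];
           [:: 1; 0; 0; 0; 0; 1]]);
      (20, [:: [:: 9; 1]; [:: 3; 2]; [:: 4; 0; 1]; [:: 1; 1; 1];
           [:: 0; 0; 0; 0; 0; 0; 0; 1]]);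
      (22, [:: [:: 10; 1]; [:: 4; 0; 0; 1]; [:: 2; 0; 0; 0; 1];
           [:: 1; 1; 0; 1]; [:: 0; 0; 1; 1]]);
      (24, [:: [:: 11; 1]; [:: 1; 3]; [:: 5; 0; 1]; [:: 1; 0; 2];
           [:: 2; 0; 0; 0; 0; 1]; [:: 0; 1; 0; 0; 1]]);
      (26, [:: [:: 12; 1]; [:: 5; 0; 0; 1]; [:: 2; 1; 1];
           [:: 1; 0; 0; 0; 0; 0; 1]; [:: 0; 1; 0; 0; 0; 1]]);
      (28, [:: [:: 13; 1]; [:: 5; 2]; [:: 6; 0; 1]; [:: 0; 2; 1];
           [:: 3; 0; 0; 0; 1]; [:: 0; 0; 1; 0; 1]; [:: 2; 1; 0; 1];
           [:: 1; 0; 0; 0; 0; 0; 0; 1]]);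
      (30, [:: [:: 14; 1]; [:: 2; 3]; [:: 6; 0; 0; 1]; [:: 0; 2; 0; 1];
           [:: 3; 0; 0; 0; 0; 1]; [:: 0; 0; 0; 0; 0; 0; 0; 0; 1];
           [:: 1; 0; 1; 1]]) ].

Lemma vectors_by_norm_table g :
  vectors_by_norm g =
    [seq (p.1%:Z, [seq comb g s | s <- p.2]) | p <- short_table].
Proof.
pose terms s :=
  [seq g (inord i) *+ nth 0%N s i | i <- iota 0 10 & nth 0%N s i != 0%N].
(* Dropping the zero terms, and adding the others from the left, gives the
   expressions in the list up to conversion, as x *+ 1 is convertible to x. *)
have combE s : comb g s = if terms s is x :: t then foldl +%R x t else 0.
  have -> : comb g s = \sum_(x <- terms s) x.
    rewrite big_map big_filter big_mkcond -[iota 0 10]/(index_iota 0 10).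
    rewrite big_mkord; apply: eq_bigr => i _; rewrite inord_val.
    by case: eqVneq => [->|//]; rewrite mulr0n.
  case: (terms s) => [|x t]; rewrite ?big_nil // big_cons.
  elim: t x => [|y t IHt] x /=; first by rewrite big_nil addr0.
  by rewrite big_cons addrA IHt.
rewrite (eq_map (fun p => congr1 (pair _) (eq_map combE p.2))).
by [].
Qed.

(** The enumerated vectors have all ten coordinates, so the trailing zeros are
    restored before comparing. *)
Definition pad (s : seq nat) : seq nat := mkseq (nth 0%N s) 10.

Lemma comb_pad g s : comb g (pad s) = comb g s.
Proof. by apply: eq_bigr => i _; rewrite nth_mkseq. Qed.

Lemma short_table_complete s : size s = 10 -> (0 < norm s <= 30)%N ->
  foldr gcdn 0%N s = 1%N ->
  exists2 p, p \in short_table & p.1 = norm s /\ s \in map pad p.2.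
Proof.
have /allP complete : all (fun s => (0 < norm s)%N ==>
    (foldr gcdn 0%N s == 1%N) ==>
    has (fun p => (p.1 == norm s) && (s \in map pad p.2)) short_table)
  (short_tails 10) by vm_compute.
move=> s10 norm_s /eqP gcd1; have /andP[norm_gt0 _] := norm_s.
have := complete s (mem_short_tails _ s10 norm_s).
move=> /implyP/(_ norm_gt0)/implyP/(_ gcd1)/hasP[p p_in /andP[/eqP <- sp]].
by exists p.
Qed.

Lemma short_table_sound p s : p \in short_table -> s \in p.2 ->
  [/\ (0 < p.1 <= 30)%N, (size s <= 10)%N, norm s = p.1
    & foldr gcdn 0%N s = 1%N].
Proof.
have /allP sound : all (fun p => (0 < p.1 <= 30)%N && all (fun s =>
    [&& (size s <= 10)%N, norm s == p.1 & foldr gcdn 0%N s == 1%N]) p.2)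
  short_table by vm_compute.
move=> /sound /andP[-> /allP sP] /sP.
by case/and3P=> -> /eqP -> /eqP ->.
Qed.

Theorem theorem3p3 (R : realType) (g : 'I_10 -> L) (hg : E10_weights g)
    (v : L) (n : int) :
  [/\ primitive v, ~ isotropic v, sqnorm v <= 30, D g (realify R v)
    & sqnorm v = n]
  <-> exists2 vs, (n, vs) \in vectors_by_norm g & v \in vs.
Proof.
have gP : Zbasis g by case: hg.
rewrite vectors_by_norm_table; split.
  case=> prim aniso le30 /(D_comb _ _ _ gP)[s s10 vE] <-; subst v.
  move/(primitive_comb _ _ gP): prim; rewrite s10 => /(_ isT) gcd1.
  move: aniso le30; rewrite /isotropic sqnorm_comb // lez_nat => aniso le30.
  have norm_s : (0 < norm s <= 30)%N.
    by rewrite le30 lt0n andbT; apply/eqP => s0; apply: aniso; rewrite s0.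
  have [p p_in [<- /mapP[t t_in ->]]] := short_table_complete _ s10 norm_s gcd1.
  exists [seq comb g u | u <- p.2]; first by apply/mapP; exists p.
  by rewrite comb_pad map_f.
case=> vs /mapP[p p_in [-> ->]] /mapP[s s_in ->].
have [/andP[p_gt0 p_le] s10 norm_s gcd1] := short_table_sound _ _ p_in s_in.
have sqn : sqnorm (comb g s) = p.1%:Z by rewrite sqnorm_comb // norm_s.
split=> //.
- exact/primitive_comb.
- by rewrite /isotropic sqn => -[p0]; rewrite p0 in p_gt0.
- by rewrite sqn lez_nat.
- apply/(D_comb _ _ _ gP); exists (pad s); first by rewrite size_mkseq.
  by rewrite comb_pad.
Qed.
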